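(* The alternating group $A_5$ is, up to isomorphism, the unique non-solvable finite group $G$ with $\eta(G)=4$. That is, $A_5$ is non-solvable with $\eta(A_5)=4$, and every non-solvable finite group $G$ with $\eta(G)=4$ is isomorphic to $A_5$.
   Context: For a finite group $G$, $\omega(G)$ denotes the set of orders of elements of $G$ and $\eta(G)=|\omega(G)|$. *)

(* Defs.v *)
From mathcomp Require Import all_boot all_fingroup all_solvable.

Set Implicit Arguments.
Unset Strict Implicit.
Unset Printing Implicit Defensive.

Local Open Scope group_scope.

(* A subset of nat is represented by a duplicate-free sequence, so its
   cardinality is its size. *)
Definition omega (gT : finGroupType) (G : {set gT}) : seq nat :=
  undup [seq #[x] | x in G].

Definition eta (gT : finGroupType) (G : {set gT}) : nat := size (omega G).

(* Main.v *)
Require Import Defs.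
From mathcomp Require Import all_boot all_fingroup all_solvable.
From mathcomp Require Import ssralg zify.
From mathcomp Require vcharacter integral_char.

(** Suppose that G is not solvable and that its elements have exactly four
    orders.  By the theorem of Burnside on groups of order p^a q^b, at least
    three primes divide #|G|; with 1 they already give four orders, so exactly
    three primes occur and every nontrivial element of G has prime order.  Two
    commuting nontrivial elements then have the same order, so the centraliser
    of an element of order p is a p-group.  This is the only source of rigidity
    and it is used at every step.

    Solvable groups of this kind are understood by [Fitting_index_prime]: the
    Fitting subgroup F is a p-group and its index is 1 or a prime.  If it
    is not 1, some subgroup Q of prime order q != p acts without fixed points on
    the centre of F.  Were G / F larger than Q, there would be an element z
    outside F Q normalising Q and such that all z x u with x in Q and u in Z(F)
    have the same prime order s; expanding (z x u)^s = 1 turns this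
    into the vanishing of norms on Z(F), and adding up these norms
    ([norm_expg_trivial]) shows that q kills the p-group Z(F), which is absurd.

    If #|G| is odd, a minimal counterexample is simple with all proper
    subgroups solvable.  The structure of the normalisers of p-subgroups forces
    distinct Sylow subgroups to meet trivially, Frobenius' theorem excludes
    self-normalising Sylow subgroups, and so a Sylow p-subgroup P has index at
    least 3 in its normaliser.  Hence fewer than a third of the elements have
    order p, for each of the three primes p, which leaves nothing to cover the
    whole of G ([odd_prime_orders_solvable]).

    If #|G| is even, let t be an involution and S its centraliser, of order q.
    Then S is an elementary abelian Sylow 2-subgroup, it is the centraliser of
    each of its involutions, and all involutions of G are conjugate, so that the
    normaliser of S acts transitively on the q - 1 involutions of S; the
    solvable case makes p = q - 1 a prime, or else q = 2.  The number of
    involutions of G is now computed in a second way: an involution u outside S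
    is determined by the element t u, which t inverts and whose order is one of
    the two odd primes p and r.  The centraliser of an inverted element is an
    abelian Sylow subgroup, and the elements of order s inverted by t form a
    class support under S, so there are none or half of (n_s - 1) q, where n_s
    is the s-part of #|G|.  The resulting equation excludes q = 2 and
    has the only solution n_p = q - 1, n_r = q + 1 ([sylow_orders_arith]).

    So #|G| = q (q - 1) (q + 1).  If r were 3, then t would invert q^2 / 2
    elements of order 3, but the braid relation allows at most one of them per
    Sylow 2-subgroup other than S ([card_inverted3_bound]), and there are only
    q of those.  As q is a power of 2, the factor divisible by 3 must be the
    prime q - 1, so q = 4 and #|G| = 60.  Conjugation on the five Sylow
    2-subgroups then identifies G with the alternating group. *)

Set Implicit Arguments.
Unset Strict Implicit.
Unset Printing Implicit Defensive.

Local Open Scope group_scope.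

(** * Groups whose nontrivial elements have prime order *)

Definition prime_orders (gT : finGroupType) (G : {set gT}) :=
  forall x, x \in G -> x != 1 -> prime #[x].

Section PrimeOrders.

Variable gT : finGroupType.
Implicit Types (G H K N P Q V : {group gT}) (x y z v : gT) (s : nat).

Lemma prime_ordersS G H : H \subset G -> prime_orders G -> prime_orders H.
Proof. by move=> sHG poG x Hx; apply: poG; apply: (subsetP sHG). Qed.

Lemma order_pgroup G s x :
  prime_orders G -> s.-group G -> x \in G -> x != 1 -> #[x] = s.
Proof.
move=> poG sG Gx ntx; have pr := poG x Gx ntx.
have := mem_p_elt sG Gx; rewrite /p_elt -{1}[#[x]]expn1 pnatX orbF pnatE //.
by move/eqP.
Qed.

(** If the orders were distinct primes, the product would have composite
    order. *)
Lemma order_comm G x y :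
    prime_orders G -> x \in G -> y \in G -> x != 1 -> y != 1 ->
  commute x y -> #[x] = #[y].
Proof.
move=> poG Gx Gy ntx nty cxy; apply/eqP/contraT => neq.
have pr_x := poG x Gx ntx; have pr_y := poG y Gy nty.
have co : coprime #[x] #[y] by rewrite prime_coprime // dvdn_prime2.
have oxy := orderM cxy co.
have ntxy : x * y != 1.
  rewrite -order_eq1 oxy; apply/eqP => h.
  by have := prime_gt1 pr_x; have := prime_gt1 pr_y; nia.
have := poG _ (groupM Gx Gy) ntxy; rewrite oxy => pr.
have /primeP[_ /(_ #[x] (dvdn_mulr _ (dvdnn _)))] := pr.
have := prime_gt1 pr_x; have := prime_gt1 pr_y => h1 h2 /orP[] /eqP h; nia.
Qed.

Lemma cent1_pgroup G x :
  prime_orders G -> x \in G -> x != 1 -> #[x].-group 'C_G[x].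
Proof.
move=> poG Gx ntx; apply/pgroupP => q q_pr /Cauchy[] // y.
rewrite inE => /andP[Gy /cent1P cxy] oy.
have nty : y != 1 by rewrite -order_gt1 oy prime_gt1.
by rewrite inE -oy; apply/eqP/esym/(order_comm poG).
Qed.

(** An s-th power falling into N can only happen for an element outside N if s
    is its order: otherwise s is prime to the order, and the element is a power
    of its s-th power. *)
Lemma expg_prime_mod G N s x :
    prime_orders G -> x \in G -> x \notin N -> prime s -> x ^+ s \in N ->
  x ^+ s = 1.
Proof.
move=> poG Gx nNx s_pr Nxs.
have ntx : x != 1 by apply: contraNneq nNx => ->.
have pr := poG x Gx ntx.
case: (eqVneq #[x] s) => [<-|neq]; first exact: expg_order.
have co : coprime #[x] s by rewrite prime_coprime // dvdn_prime2.
case/negP: nNx; rewrite -(expgK (G := <[x]>%G) co (cycle_id x)).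
by rewrite groupX.
Qed.

Lemma prime_orders_quotient G N : N <| G -> prime_orders G -> prime_orders (G / N).
Proof.
move=> /andP[_ nNG] poG _ /morphimP[x Nx Gx ->] ntNx.
have ntx : x != 1 by apply: contraNneq ntNx => ->; rewrite morph1.
have pr := poG x Gx ntx; have := morph_order (coset_morphism N) Nx.
have /primeP[_ h] := pr => /h; rewrite order_eq1 (negPf ntNx) /= => /eqP e.
by rewrite [#[_]]e.
Qed.

Import FiniteModule GRing.Theory.

(** The powers of h v are the powers of h times partial norms of v; writing the
    abelian group V additively turns the relation (h v)^n = 1 into the vanishing
    of a norm, which can be summed over several h. *)
Lemma expg_mul_norm V (abelV : abelian V) h v n :
    h \in 'N(V) -> v \in V ->
  ((h * v) ^+ n = h ^+ n * fmval (\sum_(i < n) fmod abelV v ^@ (h ^+ i))%R)%g.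
Proof.
move=> Nh Vv; elim: n => [|n IHn].
  by rewrite big_ord0 /= !expg0 mul1g.
rewrite big_ord_recr /= expgS IHn [_ ^+ n.+1]expgS -!mulgA; congr (_ * _).
set W := (\sum_(i < n) _)%R.
have -> : fmval (W + fmod abelV v ^@ (h ^+ n))%R = fmval W * v ^ (h ^+ n).
  by rewrite /= fmvalA fmvalJ ?groupX // fmodK.
rewrite (centsP abelV (fmval W)) ?fmodP ?memJ_norm ?groupX //.
by rewrite !mulgA mulgV mul1g.
Qed.

Lemma expg_mul_lcoset Q z x n :
  z \in 'N(Q) -> x \in Q -> (z * x) ^+ n \in z ^+ n *: Q.
Proof.
move=> NQz Qx; elim: n => [|n /lcosetP[y Qy IHn]].
  by rewrite !expg0 lcoset1 group1.
have -> : (z * x) ^+ n.+1 = z ^+ n.+1 * (y ^ z * x).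
  by rewrite !expgSr IHn conjgE !mulgA mulgK.
by rewrite mem_lcoset mulKg groupM ?memJ_norm.
Qed.

(** Each relation (z x u)^s = 1 says that the norm of v under the cyclic group
    generated by z x vanishes.  Summing these norms over x in Q, the terms of
    exponent 0 give #|Q| copies of v.  For 0 < i < s the elements (z x)^i run
    over the coset z^i Q, because i is prime to s, and the sum over a coset of Q
    is a Q-norm, hence fixed by Q, hence trivial as Q has no fixed points in V.
    The lemma serves twice: with z commuting with Q it shows that a group acting
    without fixed points has no noncyclic abelian q-subgroup, and with z acting
    on Q it excludes a further layer above Q. *)
Lemma norm_expg_trivial V Q z s v :
    abelian V -> prime s -> z \in 'N(V) -> z \in 'N(Q) -> Q \subset 'N(V) ->
    'C_V(Q) = 1 ->
    (forall x u, x \in Q -> u \in V -> (z * x * u) ^+ s = 1) ->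
  v \in V -> v ^+ #|Q| = 1.
Proof.
move=> abelV s_pr NVz NQz nVQ cVQ zs1 Vv.
have s_gt0 := prime_gt0 s_pr.
have NVx x : x \in Q -> x \in 'N(V) by apply: (subsetP nVQ).
have zx1 x : x \in Q -> (z * x) ^+ s = 1.
  by move=> Qx; have := zs1 x 1 Qx (group1 _); rewrite mulg1.
have norm0 x : x \in Q ->
    (\sum_(i < s) fmod abelV v ^@ ((z * x) ^+ i) = 0)%R.
  move=> Qx; apply: fmod_inj; have NVzx := groupM NVz (NVx x Qx).
  by have := zs1 x v Qx Vv; rewrite (expg_mul_norm abelV) // zx1 // mul1g.
have normQ0 (w : fmod_of abelV) : (\sum_(x in Q) w ^@ x = 0)%R.
  apply: fmod_inj; apply/set1gP; rewrite -cVQ inE fmodP /=.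
  apply/centP => y Qy; apply/commgP/conjg_fixP.
  rewrite -fmvalJ ?NVx // actr_sum; congr fmval.
  rewrite [RHS](reindex_inj (mulIg y)) /=.
  by apply: eq_big => x; rewrite ?groupMr // => Qx; rewrite actrM ?NVx.
have sum0 : (\sum_(i < s) \sum_(x in Q) fmod abelV v ^@ ((z * x) ^+ i) = 0)%R.
  by rewrite exchange_big big1 // => x Qx; apply: norm0.
case: s s_pr s_gt0 zs1 zx1 norm0 sum0 => // s s_pr _ zs1 zx1 norm0.
rewrite big_ord_recl /= [X in (_ + X)%R]big1 => [|i _].
  rewrite addr0; under eq_bigr do rewrite expg0 actr1.
  rewrite sumr_const -fmodX // => /(congr1 fmval).
  by rewrite fmodK ?groupX.
(* The index shift of the sum makes the exponent j range over 1, ..., s - 1. *)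
set j := bump 0 i.
have co_s_j : coprime s.+1 j.
  by rewrite prime_coprime // /j /bump add1n gtnNdvd // ltnS.
pose f x := (z ^+ j)^-1 * (z * x) ^+ j.
have fQ x : x \in Q -> f x \in Q.
  by move=> Qx; rewrite -mem_lcoset expg_mul_lcoset.
have f_inj : {in Q &, injective f}.
  move=> x y Qx Qy /mulgI eq_j; apply: (mulgI z).
  have j_gt0 : (0 < j)%N by rewrite /j /bump.
  have [k l kj _] := egcdnP s.+1 j_gt0.
  rewrite gcdnC (eqP co_s_j) in kj.
  have root (u : gT) : u ^+ s.+1 = 1 -> u ^+ (j * k) = u.
    by move=> u1; rewrite mulnC kj expgnDr [(l * _)%N]mulnC expgM u1 expg1n mul1g.
  by rewrite -(root _ (zx1 x Qx)) -(root _ (zx1 y Qy)) !expgM eq_j.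
have imf : f @: Q = Q.
  apply/eqP; rewrite eqEcard card_in_imset // leqnn andbT.
  by apply/subsetP => _ /imsetP[x Qx ->]; apply: fQ.
rewrite -[RHS](normQ0 (fmod abelV v ^@ (z ^+ j))%R) -[in RHS]imf big_imset //=.
apply: eq_bigr => x Qx; rewrite -actrM ?groupX // ?NVx ?fQ //.
by rewrite /f mulKVg.
Qed.

End PrimeOrders.

(** * The solvable case *)

Section SolvablePrimeOrders.

Variable gT : finGroupType.
Implicit Types (G H K N P Q V : {group gT}) (x y z v : gT) (s p q : nat).

(** A nontrivial central element commutes with everything, so its order is the
    order of every element. *)
Lemma nilpotent_prime_orders_pgroup G :
  nilpotent G -> prime_orders G -> exists2 p, prime p & p.-group G.
Proof.
move=> nilG poG; have [G1|ntG] := eqVneq (G : {set gT}) 1.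
  by exists 2; rewrite ?G1 ?pgroup1.
have /trivgPn[z Zz ntz]: 'Z(G) != 1 by rewrite center_nil_eq1.
have [Gz cGz] := setIP Zz.
exists #[z]; first exact: poG.
apply: pgroupS (cent1_pgroup poG Gz ntz); rewrite subsetI subxx.
by rewrite sub_cent1.
Qed.

Lemma cent_cycle_trivial G V p x :
    prime_orders G -> V \subset G -> p.-group V -> x \in G -> x != 1 ->
  #[x] != p -> 'C_V(<[x]>) = 1.
Proof.
move=> poG sVG pV Gx ntx neq; apply/trivgP/subsetP => v /setIP[Vv cvx].
apply/set1gP; apply: contraNeq neq => ntv.
rewrite -(order_pgroup (prime_ordersS sVG poG) pV Vv ntv).
rewrite (order_comm poG Gx (subsetP sVG _ Vv) ntx ntv) //.
by apply/commute_sym/(centP cvx)/cycle_id.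
Qed.

(** Let K / F be a minimal normal subgroup of G / F, a q-group with q != p since
    F is the largest normal p-subgroup, and let Q be a Sylow q-subgroup of K.
    It acts without fixed points on the centre V of F.  An element of Q outside
    a subgroup of order q, or an element of the normaliser of Q outside K, would
    satisfy the hypotheses of [norm_expg_trivial] and make q kill V.  So Q has
    order q, and by the Frattini argument G = K. *)
Theorem Fitting_index_prime G :
    solvable G -> prime_orders G ->
  exists p, [/\ prime p, p.-group 'F(G)
              & 'F(G) = G :> {set gT} \/ prime #|G : 'F(G)|].
Proof.
move=> solG poG; set F := 'F(G)%G.
have sFG : F \subset G := Fitting_sub G.
have nsFG : F <| G := Fitting_normal G.
have [p p_pr pF] :=
  nilpotent_prime_orders_pgroup (Fitting_nil G) (prime_ordersS sFG poG).
exists p; split => //.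
have [-> | neqFG] := eqVneq (F : {set gT}) G; [by left | right].
have ntF : F :!=: 1.
  rewrite trivg_Fitting //; apply: contraNneq neqFG => G1.
  by rewrite eqEsubset sFG G1 sub1G.
pose V := 'Z(F)%G.
have ntV : V :!=: 1 by rewrite center_nil_eq1 ?Fitting_nil.
have abelV : abelian V := center_abelian F.
have sVF : V \subset F := center_sub F.
have sVG := subset_trans sVF sFG.
have pV : p.-group V := pgroupS sVF pF.
have nVG : G \subset 'N(V).
  exact/normal_norm/(char_normal_trans (center_char F)).
have nFG := normal_norm nsFG.
have no_norm Q z s : Q \subset G -> z \in G -> z \in 'N(Q) -> prime s ->
    'C_V(Q) = 1 -> prime #|Q| -> #|Q| != p ->
  (forall x u, x \in Q -> u \in V -> (z * x * u) ^+ s = 1) -> False.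
  move=> sQG Gz nQz s_pr cVQ Q_pr neqQp zs1.
  have /trivgPn[v Vv ntv] := ntV.
  have vQ1 : v ^+ #|Q| = 1.
    by apply: norm_expg_trivial zs1 Vv; rewrite ?(subsetP nVG) ?(subset_trans sQG).
  case/negP: neqQp; rewrite -(order_pgroup (prime_ordersS sVG poG) pV Vv ntv).
  by rewrite (nt_prime_order Q_pr vQ1 ntv).
have ntGF : G / F != 1.
  rewrite -subG1 quotient_sub1 //; apply: contra neqFG => sGF.
  by rewrite eqEsubset sFG.
have [Kb [_ nsKb ntKb /is_abelemP[q q_pr abKb]]] :=
  solvable_norm_abelem (quotient_sol F solG) (normal_refl _) ntGF.
have [K defKb sFK nsKG] := inv_quotientN nsFG nsKb; rewrite defKb in ntKb abKb.
have nFK := subset_trans (normal_sub nsKG) nFG.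
have qK : q.-group (K / F) := abelem_pgroup abKb.
have oK : #|K| = (#|F| * #|K / F|)%N by rewrite card_quotient // Lagrange.
have neq_pq : q != p.
  apply: contra ntKb => /eqP eqpq; rewrite -subG1 quotient_sub1 //.
  apply: Fitting_max nsKG (pgroup_nil (p := p) _).
  by rewrite /pgroup oK pnatM [p.-nat _]pF -eqpq.
have [Q sylQ] := Sylow_exists q K; have [sQK qQ _] := and3P sylQ.
have sQG := subset_trans sQK (normal_sub nsKG).
have coFQ : coprime #|F| #|Q|.
  by apply: pnat_coprime pF (pi_pnat qQ _); rewrite !inE.
have tiFQ := coprime_TIg coFQ.
have oQ : #|Q| = #|K / F|.
  rewrite (card_Hall sylQ) oK partnM // (part_pnat_id qK).
  rewrite part_p'nat ?mul1n //.
  by apply: pi_pnat pF _; rewrite !inE eq_sym.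
have ntQ : Q :!=: 1 by rewrite -cardG_gt1 oQ cardG_gt1.
have abQ : abelian Q.
  rewrite (isog_abelian (quotient_isog (subset_trans sQK nFK) tiFQ)).
  exact: abelianS (quotientS F sQK) (abelem_abelian abKb).
have /trivgPn[x0 Qx0 ntx0] := ntQ.
have Gx0 := subsetP sQG x0 Qx0.
have ox0 : #[x0] = q := order_pgroup (prime_ordersS sQG poG) qQ Qx0 ntx0.
have sx0Q : <[x0]> \subset Q by rewrite cycle_subG.
have sx0G := subset_trans sx0Q sQG.
have cVx0 : 'C_V(<[x0]>) = 1
  by apply: (cent_cycle_trivial poG sVG pV Gx0 ntx0); rewrite ox0.
have defQ : Q :=: <[x0]>.
  apply/eqP; rewrite eqEsubset sx0Q andbT; apply/subsetP => z Qz.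
  apply/contraT => nx0z; case: (no_norm <[x0]>%G z q); rewrite /= -?orderE ?ox0 //.
  - exact: (subsetP sQG).
  - exact: (subsetP (sub_abelian_norm abQ sx0Q)).
  move=> x u x0x Vu; have Qx := subsetP sx0Q x x0x.
  have Kz := subsetP sQK z Qz; have Kx := subsetP sQK x Qx.
  have Fu := subsetP sVF u Vu; have Ku := subsetP sFK u Fu.
  have Kzxu : z * x * u \in K by rewrite !groupM.
  apply: (expg_prime_mod (N := F) poG) => //.
  - exact: (subsetP (normal_sub nsKG)).
  - rewrite groupMr //; apply: contra nx0z => Fzx.
    have: z * x \in F :&: Q by rewrite inE Fzx groupM.
    by rewrite tiFQ -(groupMr z x0x) => /set1gP->.
  apply: coset_idr; first by rewrite groupX ?(subsetP nFK).
  rewrite morphX ?(subsetP nFK) //.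
  by case/abelemP: abKb => // _ ->; rewrite ?mem_quotient.
have oQq : #|Q| = q by rewrite defQ -orderE.
suffices defG : G :=: K.
  by rewrite -[#|_ : _|]/(#|G : F|) defG -card_quotient // -oQ oQq.
apply/eqP; rewrite eqEsubset (normal_sub nsKG) andbT.
rewrite -(Frattini_arg nsKG sylQ) mul_subG //.
apply/subsetP => z /setIP[Gz nQz]; apply/contraT => nKz.
have ntz : z != 1 by apply: contraNneq nKz => ->.
case: (no_norm Q z #[z]) => //; rewrite ?oQq ?poG //; first by rewrite defQ.
move=> x u Qx Vu; have Kx := subsetP sQK x Qx.
have Ku : u \in K by rewrite (subsetP sFK) ?(subsetP sVF).
rewrite -mulgA; apply: (expg_prime_mod (N := K) poG).
- by apply: groupM => //; apply: (subsetP (normal_sub nsKG)); rewrite groupM.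
- by rewrite groupMr ?groupM.
- exact: poG.
have:= @expg_mul_lcoset _ K z (x * u) #[z].
rewrite expg_order lcoset1; apply; last exact: groupM.
exact: (subsetP (normal_norm nsKG)).
Qed.

End SolvablePrimeOrders.

Section NormalPSubgroup.

Variable gT : finGroupType.
Implicit Types (G D N P : {group gT}) (p : nat).

(** The prime index cannot be p: the group would then be a p-group, equal to its
    Fitting subgroup. *)
Lemma Fitting_Sylow p N D :
    solvable N -> prime_orders N -> D <| N -> D :!=: 1 -> p.-group D ->
  p.-Sylow(N) 'F(N) /\ ('F(N) = N :> {set gT} \/ prime #|N : 'F(N)|).
Proof.
move=> solN poN nsDN ntD pD; have [q [q_pr qF idx]] := Fitting_index_prime solN poN.
have sDF : D \subset 'F(N) := Fitting_max nsDN (pgroup_nil pD).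
have eqpq : p = q.
  have /trivgPn[x Dx ntx] := ntD.
  rewrite -(order_pgroup (prime_ordersS (normal_sub nsDN) poN) pD Dx ntx).
  exact: order_pgroup (prime_ordersS (Fitting_sub N) poN) qF (subsetP sDF x Dx) ntx.
split=> //; rewrite /pHall Fitting_sub eqpq [_.-group _]qF /=.
case: idx => [->|r_pr]; first by rewrite indexgg.
rewrite pnatE // !inE; apply/eqP => e.
have qN : q.-group N.
  by rewrite /pgroup -(Lagrange (Fitting_sub N)) e pnatM [_.-nat _]qF pnat_id.
by move: r_pr; rewrite (nilpotent_Fitting (pgroup_nil qN)) indexgg.
Qed.

End NormalPSubgroup.

(** * The odd order case *)

Section OddSimple.

Variables (gT : finGroupType) (G : {group gT}).
Hypotheses (oddG : odd #|G|) (poG : prime_orders G) (simG : simple G).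
Hypotheses (nsolG : ~~ solvable G).
Hypothesis solproper : forall H : {group gT}, H \proper G -> solvable H.
Implicit Types (P Q D : {group gT}) (p : nat).

Lemma norm_pgroup_proper p D :
  D \subset G -> D :!=: 1 -> p.-group D -> 'N_G(D) \proper G.
Proof.
move=> sDG ntD pD; rewrite properE subsetIl subsetI subxx /=.
apply/negP => nDG; have nsDG : D <| G by rewrite /normal sDG.
have [_ /(_ D nsDG)[D1|DG]] := simpleP _ simG; first by rewrite D1 eqxx in ntD.
by move: nsolG; rewrite -DG (pgroup_sol pD).
Qed.

(** Let the intersection D be nontrivial and as large as possible.  The
    normaliser of D is solvable, so it has a normal Sylow p-subgroup T, which
    contains the normalisers of D in P and in Q.  These are larger than D, so a
    Sylow subgroup R containing T meets both P and Q in more than D, and by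
    maximality P = R = Q. *)
Lemma odd_simple_Sylow_TI p P Q :
  p.-Sylow(G) P -> p.-Sylow(G) Q -> P :&: Q != 1 -> P :=: Q.
Proof.
have [n] := ubnP (#|G| - #|P :&: Q|); elim: n => // n IHn in P Q *.
rewrite ltnS => le_n sylP sylQ ntD; apply/eqP/contraT => neqPQ.
set D := (P :&: Q)%G; have [sPG pP _] := and3P sylP; have [sQG pQ _] := and3P sylQ.
have sDP : D \subset P by apply: subsetIl.
have sDQ : D \subset Q by apply: subsetIr.
have pD : p.-group D := pgroupS sDP pP.
have sDG := subset_trans sDP sPG.
have eqPQ : #|P| = #|Q| by rewrite (card_Hall sylP) (card_Hall sylQ).
have prDP : D \proper P.
  rewrite properE sDP; apply: contra neqPQ => sPD.
  by rewrite eqEcard (subset_trans sPD sDQ) eqPQ leqnn.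
have prDQ : D \proper Q.
  rewrite properE sDQ; apply: contra neqPQ => sQD.
  by rewrite eq_sym eqEcard (subset_trans sQD sDP) eqPQ leqnn.
have prN := norm_pgroup_proper sDG ntD pD.
have [sylT _] := Fitting_Sylow (solproper prN) (prime_ordersS (subsetIl _ _) poG)
  (normalSG sDG) ntD pD.
set T := 'F('N_G(D))%G in sylT.
have [sTN pT _] := and3P sylT.
have [R sylR sTR] := Sylow_superset (subset_trans sTN (subsetIl _ _)) pT.
have eqR (X : {group gT}) : p.-Sylow(G) X -> D \proper X -> X :=: R.
  move=> sylX prX; have [sXG pX _] := and3P sylX.
  have sNX : 'N_X(D) \subset X :&: R.
    rewrite subsetI subsetIl (subset_trans _ sTR) //.
    rewrite (sub_normal_Hall sylT) ?Fitting_normal ?setSI //.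
    exact: pgroupS (subsetIl _ _) pX.
  have ltD : #|D| < #|X :&: R|.
    apply: leq_trans (subset_leq_card sNX).
    by apply/proper_card/nilpotent_proper_norm; rewrite ?(pgroup_nil pX).
  apply: IHn => //; last by rewrite -cardG_gt1 (leq_ltn_trans (cardG_gt0 D)).
  apply: leq_trans le_n; apply: ltn_sub2l => //.
  by apply: leq_trans ltD _; rewrite subset_leq_card // subIset // sXG.
by rewrite (eqR P) // (eqR Q) // eqxx in neqPQ.
Qed.

Lemma odd_simple_normedTI p P :
  p.-Sylow(G) P -> P :!=: 1 -> normedTI P^# G 'N_G(P).
Proof.
move=> sylP ntP; apply/normedTI_P; split; first by rewrite setD_eq0 subG1.
  by rewrite normD1.
move=> g Gg; rewrite conjD1g -setI_eq0.
case/set0Pn => x /setIP[/setD1P[ntx Px] /setD1P[_ Pgx]].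
rewrite inE Gg; apply/normP/esym.
apply: (odd_simple_Sylow_TI sylP); first by rewrite pHallJ.
by apply/trivgPn; exists x; rewrite // inE Px.
Qed.

(** Otherwise P would be a Frobenius complement, and the Frobenius kernel a
    proper nontrivial normal subgroup. *)
Lemma odd_simple_Sylow_not_selfnorm p P :
  p.-Sylow(G) P -> P :!=: 1 -> 'N_G(P) != P.
Proof.
move=> sylP ntP; apply/eqP => defN; have [_ pP _] := and3P sylP.
have neqPG : P :!=: G.
  by apply: contraNneq nsolG => <-; apply: pgroup_sol pP.
have [|K /andP[/eqP defG _]] := @vcharacter.Frobenius_kernel_exists _ G P.
  by rewrite /Frobenius_group_with_complement neqPG -[X in normedTI _ _ X]defN
             (odd_simple_normedTI sylP).
have [nsKG _ mulKP _ tiKP] := sdprod_context defG.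
have [_ /(_ K nsKG)[K1|KG]] := simpleP _ simG.
  by rewrite -mulKP K1 mul1g eqxx in neqPG.
by rewrite -tiKP KG (setIidPr _) ?eqxx ?(pHall_sub sylP) // in ntP.
Qed.

(** The elements of order p are the conjugates of the nontrivial elements of P,
    and P has index at least 3 in its normaliser because this index is a prime
    dividing the odd number #|G|. *)
Lemma odd_simple_count p :
  p \in \pi(G) -> (3 * #|[set x in G | #[x] == p]| + 2 <= #|G|)%N.
Proof.
rewrite mem_primes => /and3P[p_pr _ p_dvG].
have [P sylP] := Sylow_exists p G; have [sPG pP _] := and3P sylP.
have ntP : P :!=: 1.
  by rewrite -cardG_gt1 (card_Hall sylP) p_part_gt1 mem_primes p_pr cardG_gt0.
set N := 'N_G(P)%G; have sPN : P \subset N by rewrite subsetI sPG normG.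
have sNG : N \subset G by apply: subsetIl.
have [sylF idx] := Fitting_Sylow (solproper (norm_pgroup_proper sPG ntP pP))
  (prime_ordersS (subsetIl _ _) poG) (normalSG sPG) ntP pP.
have defF : 'F(N) = P.
  apply: (sub_pHall (pHall_subl sPN sNG sylP)).
  - by have [] := and3P sylF.
  - by rewrite Fitting_max ?(pgroup_nil pP) ?normalSG.
  - exact: Fitting_sub.
have e_ge3 : (2 < #|N : P|)%N.
  have odd_e : odd #|N : P| by apply: dvdn_odd (dvdn_indexg _ _) (oddSg sNG oddG).
  move: idx; rewrite -/N defF => -[eqPN|e_pr].
    by case/eqP: (odd_simple_Sylow_not_selfnorm sylP ntP).
  exact: odd_prime_gt2.
have sub : [set x in G | #[x] == p] \subset class_support P^# G.
  apply/subsetP => x; rewrite inE => /andP[Gx /eqP ox].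
  have px : p.-group <[x]> by rewrite /pgroup -orderE ox pnat_id.
  have [|y Gy] := Sylow_Jsub sylP _ px; first by rewrite cycle_subG.
  rewrite -cycleJ cycle_subG => Pxy; rewrite -(conjgK y x).
  apply: memJ_class_support; last by rewrite groupV.
  by rewrite !inE Pxy conjg_eq1 -order_gt1 ox prime_gt1.
have := subset_leq_card sub.
rewrite (card_support_normedTI (odd_simple_normedTI sylP ntP)).
have oG : #|G| = (#|P| * (#|N : P| * #|G : N|))%N.
  by rewrite -(Lagrange sNG) -(Lagrange sPN) mulnA.
rewrite oG (cardsD1 1 P) group1 add1n -/N /=.
have i_gt0 : (0 < #|G : N|)%N by [].
move: #|_ : N| i_gt0 #|_ : P| e_ge3 #|P^#| => i i_gt0 e e_ge3 c le_c.
apply: leq_trans (_ : c.+1 * (3 * i) <= _)%N; last first.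
  by rewrite leq_mul2l leq_mul2r e_ge3 orbT.
have -> : (c.+1 * (3 * i) = 3 * (c * i) + 3 * i)%N by rewrite mulSn addnC mulnCA.
by apply: leq_add; [rewrite leq_mul2l | apply: leq_trans (leq_mul (leqnn 3) i_gt0)].
Qed.

End OddSimple.

(** In a minimal counterexample each of at most three primes accounts for at
    most (#|G| - 2) / 3 elements, fewer than the #|G| - 1 nontrivial ones. *)
Theorem odd_prime_orders_solvable (gT : finGroupType) (G : {group gT}) :
  odd #|G| -> prime_orders G -> (size (primes #|G|) <= 3)%N -> solvable G.
Proof.
have [n] := ubnP #|G|; elim: n => // n IHn in gT G *.
rewrite ltnS => leGn oddG poG pi3.
have [simpleG | ] := boolP (simple G); last first.
  rewrite negb_forall_in => /exists_inP[N sNG]; rewrite eq_sym.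
  have [->|] := eqVneq N G.
    rewrite groupP /= genGid normG andbT eqb_id negbK => /eqP->.
    exact: solvable1.
  rewrite [N == G]eqEproper sNG eqbF_neg !negbK => ltNG /and3P[grN].
  case/isgroupP: grN => {}N -> in sNG ltNG *; rewrite /= genGid => ntN nNG.
  have nsNG: N <| G by apply/andP.
  have dv_le_pi m: (m %| #|G| -> size (primes m) <= 3)%N.
    move=> m_dv_G; apply: leq_trans pi3.
    by rewrite uniq_leq_size ?primes_uniq //; apply: pi_of_dvd.
  rewrite (series_sol nsNG) !IHn ?dv_le_pi ?cardSg ?dvdn_quotient //.
  - exact: leq_trans (ltn_quotient _ _) leGn.
  - by rewrite quotient_odd.
  - exact: prime_orders_quotient.
  - by apply: leq_trans leGn; apply: proper_card.
  - exact: oddSg oddG.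
  - exact: prime_ordersS poG.
apply/contraT => nsolG.
have solproper (H : {group gT}) : H \proper G -> solvable H.
  move=> prH; have sHG := proper_sub prH; apply: IHn.
  - exact: leq_trans (proper_card prH) leGn.
  - exact: oddSg oddG.
  - exact: prime_ordersS poG.
  apply: leq_trans pi3; rewrite uniq_leq_size ?primes_uniq //.
  by apply: pi_of_dvd; rewrite ?cardSg.
have count : (#|G^#| <= \sum_(p <- primes #|G|) #|[set x in G | #[x] == p]|)%N.
  have cover : G^# \subset \bigcup_(p <- primes #|G|) [set x in G | #[x] == p].
    apply/subsetP => x /setD1P[ntx Gx]; rewrite (big_rem #[x]) /= ?inE ?Gx ?eqxx //.
    by rewrite mem_primes poG // cardG_gt0 order_dvdG.
  apply: leq_trans (subset_leq_card cover) _.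
  elim/big_rec2: _ => [|p m A _ leAm]; first by rewrite cards0.
  apply: leq_trans (leq_card_setU _ _) _.
  by rewrite leq_add2l.
have : (3 * #|G^#| <= \sum_(p <- primes #|G|) (#|G| - 2))%N.
  apply: leq_trans (leq_mul (leqnn 3) count) _; rewrite big_distrr /=.
  rewrite [X in (X <= _)%N]big_seq [X in (_ <= X)%N]big_seq leq_sum // => p piGp.
  have := odd_simple_count oddG poG simpleG nsolG solproper piGp.
  by move/(leq_sub2r 2); rewrite addnK.
rewrite big_const_seq count_predT iter_addn_0.
move=> le_count; have := leq_trans le_count (leq_mul (leqnn _) pi3).
have : (1 < #|G|)%N.
  by rewrite cardG_gt1; apply: contraNneq nsolG => ->; apply: solvable1.
rewrite (cardsD1 1 G) group1 /=; move: #|G^#| => g; lia.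
Qed.

(** * Involutions *)

Section Involutions.

Variables (gT : finGroupType) (G : {group gT}).
Hypothesis poG : prime_orders G.
Implicit Types (t u x y z g : gT) (s : nat) (S : {group gT}).

Lemma involution_mul2 t : #[t] = 2 -> t * t = 1.
Proof. by move=> ot; rewrite -expg2 -ot expg_order. Qed.

Lemma involution_invg t : #[t] = 2 -> t^-1 = t.
Proof. by move=> ot; apply/eqP; rewrite eq_invg_mul involution_mul2. Qed.

Lemma involution_nt t : #[t] = 2 -> t != 1.
Proof. by move=> ot; rewrite -order_gt1 ot. Qed.

Lemma order_involution t : t != 1 -> t * t = 1 -> #[t] = 2.
Proof. by move=> ntt tt; apply: nt_prime_order. Qed.

(** A Sylow 2-subgroup S containing the 2-group 'C_G[t] has exponent 2, hence is
    abelian and centralises t. *)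
Lemma cent1_involution_Sylow t : t \in G -> #[t] = 2 -> 2.-Sylow(G) 'C_G[t].
Proof.
move=> Gt ot; have := cent1_pgroup poG Gt (involution_nt ot); rewrite ot => pC.
have [S sylS sCS] := Sylow_superset (subsetIl _ _) pC; have [sSG pS _] := and3P sylS.
suffices -> : 'C_G[t] = S by [].
apply/eqP; rewrite eqEsubset sCS subsetI sSG.
have ent : forall x, x \in S -> x ^+ 2 = 1.
  move=> x Sx; have [->|ntx] := eqVneq x 1; first by rewrite expg1n.
  by rewrite -(order_pgroup (prime_ordersS sSG poG) pS Sx ntx) expg_order.
have abS : 2.-abelem S by apply: exponent2_abelem; apply/exponentP.
rewrite sub_cent1; apply: subsetP (abelem_abelian abS) _ _.
by apply: (subsetP sCS); rewrite inE Gt cent1id.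
Qed.

Lemma order_cent1_involution t x :
  t \in G -> #[t] = 2 -> x \in 'C_G[t] -> x != 1 -> #[x] = 2.
Proof.
move=> Gt ot /setIP[Gx /cent1P cxt] ntx.
by rewrite -ot; apply: (order_comm poG Gx Gt ntx (involution_nt ot)).
Qed.

Lemma cent1_involution_abelian t : t \in G -> #[t] = 2 -> abelian 'C_G[t].
Proof.
move=> Gt ot; suffices: 2.-abelem 'C_G[t] by apply: abelem_abelian.
apply: exponent2_abelem; apply/exponentP => x Cx.
have [->|ntx] := eqVneq x 1; first by rewrite expg1n.
by rewrite -(order_cent1_involution Gt ot Cx ntx) expg_order.
Qed.

Lemma cent1_involution_TI t u :
  t \in G -> #[t] = 2 -> u \in 'C_G[t] -> u != 1 -> 'C_G[u] = 'C_G[t].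
Proof.
move=> Gt ot Cu ntu; have ou := order_cent1_involution Gt ot Cu ntu.
have [Gu _] := setIP Cu.
have sC a b : a \in G -> #[a] = 2 -> b \in 'C_G[a] -> 'C_G[a] \subset 'C_G[b].
  move=> Ga oa Cb; rewrite subsetI subsetIl sub_cent1.
  exact: subsetP (cent1_involution_abelian Ga oa) b Cb.
apply/eqP; rewrite eqEsubset !sC //.
by have [_ cut] := setIP Cu; rewrite in_setI Gt cent1C.
Qed.

(** The product x of t and u is inverted by t and has odd order, since an
    involution x would make t and u commute.  So x has a square root g among its
    powers, and g conjugates t to t g^2 = t x = u. *)
Lemma conj_noncommuting_involutions t u :
    t \in G -> u \in G -> #[t] = 2 -> #[u] = 2 -> u \notin 'C_G[t] ->
  u \in t ^: G.
Proof.
move=> Gt Gu ot ou; rewrite in_setI Gu /= => ncut.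
have tt := involution_mul2 ot; have uu := involution_mul2 ou.
pose x := t * u; have Gx : x \in G by rewrite groupM.
have xt : x ^ t = x^-1.
  by rewrite conjgE invMg !involution_invg // mulgA mulgA tt mul1g.
have ntx : x != 1.
  apply: contraNneq ncut => /eqP; rewrite -eq_invg_mul involution_invg //.
  by move/eqP <-; apply: cent1id.
have ox2 : #[x] != 2.
  apply: contraNneq ncut => ox; apply/cent1P.
  by move: (involution_invg ox); rewrite invMg !involution_invg.
have oddx : odd #[x].
  by case: (even_prime (poG Gx ntx)) => // e; rewrite e eqxx in ox2.
pose g := x ^+ uphalf #[x]; have Gg : g \in G by rewrite groupX.
have gg : g * g = x.
  rewrite -expgnDr addnn -[(_.*2)%N]/((uphalf #[x]).*2) uphalfE.
  by rewrite halfK /= oddx /= subn0 expgS expg_order mulg1.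
apply/imsetP; exists g => //.
have gt : g ^ t = g^-1 by rewrite conjXg xt expgVn.
have -> : t ^ g = t * (g^-1 ^ t * g) by rewrite !conjgE !mulgA mulgV mul1g.
by rewrite conjVg gt invgK gg mulgA tt mul1g.
Qed.

End Involutions.

(** * Elements of odd order inverted by an involution *)

Section InvertedElements.

Variables (gT : finGroupType) (G : {group gT}) (t : gT).
Hypotheses (poG : prime_orders G) (Gt : t \in G) (ot : #[t] = 2).
Implicit Types (u x y z g : gT) (s : nat).

Let S := 'C_G[t]%G.

Definition inverted s := [set x in G | (#[x] == s) && (x ^ t == x^-1)].

Lemma invertedP s x :
  reflect [/\ x \in G, #[x] = s & x ^ t = x^-1] (x \in inverted s).
Proof. by rewrite inE; apply: (iffP and3P) => -[-> /eqP-> /eqP->]. Qed.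

(** The element t y inverts x too, so it has even order, that is, order 2;
    and (t y)^2 = 1 says that t inverts y. *)
Lemma cent1_inverted s x y :
  odd s -> x \in inverted s -> x != 1 -> y \in 'C_G[x] -> y ^ t = y^-1.
Proof.
move=> odds /invertedP[Gx ox xt] ntx /setIP[Gy /cent1P cxy].
have Gw : t * y \in G by rewrite groupM.
have xw : x ^ (t * y) = x^-1.
  by rewrite conjgM xt; apply/conjg_fixP/commgP/commute_sym/commuteV.
have not_cxw : ~ commute x (t * y).
  move=> cxw; have: x ^ (t * y) = x by apply/conjg_fixP/commgP.
  rewrite xw => /eqP; rewrite eq_invg_mul => /eqP xx.
  by move: odds; rewrite -ox (order_involution ntx xx).
have ntw : t * y != 1.
  by apply: contra_notN not_cxw => /eqP ->; apply: commute1.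
have ow : #[t * y] = 2.
  apply/eqP/contraT => ow2; case: not_cxw.
  have oddw : odd #[t * y].
    by case: (even_prime (poG Gw ntw)) => // e; rewrite e eqxx in ow2.
  have -> : t * y = ((t * y) ^+ 2) ^+ uphalf #[t * y].
    rewrite -expgM mul2n uphalfE halfK /= oddw /= subn0 expgS expg_order.
    by rewrite mulg1.
  apply: commuteX; apply/commgP/conjg_fixP.
  by rewrite conjgM xw conjVg xw invgK.
have := involution_mul2 ow; rewrite mulgA => /eqP; rewrite -eq_invg_mul.
by move=> /eqP e; rewrite -[in RHS]e invgK conjgE (involution_invg ot) mulgA.
Qed.

Section OddInverted.

Variables (s : nat) (x0 : gT).
Hypotheses (odds : odd s) (s_pr : prime s) (Ix0 : x0 \in inverted s).

Let A := 'C_G[x0]%G.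

Lemma nt_inverted x : x \in inverted s -> x != 1.
Proof. by case/invertedP=> _ ox _; rewrite -order_gt1 ox prime_gt1. Qed.

Lemma cent1_inverted_pgroup : s.-group 'C_G[x0].
Proof.
have [Gx ox _] := invertedP _ _ Ix0.
by have := cent1_pgroup poG Gx (nt_inverted Ix0); rewrite ox.
Qed.

Lemma cent1_inverted_invg y : y \in A -> y ^ t = y^-1.
Proof. exact: cent1_inverted odds Ix0 (nt_inverted Ix0). Qed.

Lemma cent1_inverted_abelian : abelian 'C_G[x0].
Proof.
apply/centsP => y Ay z Az; have := cent1_inverted_invg (groupM Ay Az).
rewrite conjMg !cent1_inverted_invg // invMg.
by move/(congr1 invg); rewrite !invMg !invgK.
Qed.

End OddInverted.

(** Both centralisers are abelian, being inverted elementwise by t, and each of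
    x and y lies in the centraliser of the other. *)
Lemma cent1_inverted_eq s x y :
    odd s -> prime s -> x \in inverted s -> y \in 'C_G[x] -> y != 1 ->
  'C_G[y] = 'C_G[x].
Proof.
move=> odds s_pr Ix Cy nty; have [Gx ox xt] := invertedP _ _ Ix.
have [Gy cxy] := setIP Cy.
have oy : #[y] = s.
  rewrite (order_pgroup (prime_ordersS (subsetIl _ _) poG)
    (cent1_inverted_pgroup s_pr Ix) Cy nty) //.
have Iy : y \in inverted s.
  by apply/invertedP; split=> //; apply: (cent1_inverted_invg odds s_pr Ix).
have sC a b : a \in inverted s -> b \in 'C_G[a] -> 'C_G[a] \subset 'C_G[b].
  move=> Ia Cb; rewrite subsetI subsetIl sub_cent1.
  exact: subsetP (cent1_inverted_abelian odds s_pr Ia) b Cb.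
by apply/eqP; rewrite eqEsubset !sC // in_setI Gx cent1C.
Qed.

(** A central element of a Sylow s-subgroup B containing 'C_G[x] lies in
    'C_G[x], so it has the same centraliser, and this centraliser contains B. *)
Lemma cent1_inverted_Sylow s x :
  odd s -> prime s -> x \in inverted s -> s.-Sylow(G) 'C_G[x].
Proof.
move=> odds s_pr Ix; have [Gx ox xt] := invertedP _ _ Ix.
have [B sylB sAB] := Sylow_superset (subsetIl _ _) (cent1_inverted_pgroup s_pr Ix).
have [sBG sB _] := and3P sylB.
have Bx : x \in B by apply: (subsetP sAB); rewrite in_setI Gx cent1id.
have ntB : B :!=: 1 by apply/trivgPn; exists x => //; apply: nt_inverted Ix.
have /trivgPn[z Zz ntz] : 'Z(B) != 1 by rewrite center_nil_eq1 // (pgroup_nil sB).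
have [Bz cBz] := setIP Zz.
have Cz : z \in 'C_G[x].
  by rewrite in_setI (subsetP sBG) //= cent1C; apply: subsetP Bx; rewrite sub_cent1.
suffices -> : 'C_G[x] = B by [].
apply/eqP; rewrite eqEsubset sAB -(cent1_inverted_eq odds s_pr Ix Cz ntz).
by rewrite subsetI sBG sub_cent1.
Qed.

(** An element g of S normalising A = 'C_G[x] is an involution or 1; an
    involution acts on A without fixed points, so it inverts A like t does, and
    g t lies in A and in the 2-group S, hence is trivial. *)
Lemma cent1_inverted_normedTI s x :
  odd s -> prime s -> x \in inverted s -> normedTI 'C_G[x]^# S <[t]>.
Proof.
move=> odds s_pr Ix; set A := 'C_G[x]; have [Gx ox xt] := invertedP _ _ Ix.
have ntx := nt_inverted s_pr Ix.
have sA : s.-group A := cent1_inverted_pgroup s_pr Ix.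
have oA a : a \in A -> a != 1 -> #[a] = s.
  exact: order_pgroup (prime_ordersS (subsetIl _ _) poG) sA.
have tiAS a : a \in A -> a \in S -> a = 1.
  move=> Aa Sa; apply/eqP/contraT => nta; have := oA a Aa nta.
  by rewrite (order_cent1_involution poG Gt ot Sa nta) => e; rewrite -e in odds.
have At a : a \in A -> a ^ t = a^-1 by apply: (cent1_inverted_invg odds s_pr Ix).
apply/normedTI_memJ_P; split.
- by apply/set0Pn; exists x; rewrite in_setD1 ntx in_setI Gx cent1id.
- by rewrite cycle_subG in_setI Gt cent1id.
move=> a g /setD1P[nta Aa] Sg; have [Gg cgt] := setIP Sg.
apply/idP/idP => [/setD1P[_ Aag]|tg]; last first.
  have /set2P[-> | ->] : g \in [set 1; t] by rewrite -(cycle2g ot).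
    by rewrite conjg1 in_setD1 nta.
  by rewrite At // in_setD1 invg_eq1 nta groupV.
have nAg : g \in 'N(A).
  apply/normP; rewrite /A -(cent1_inverted_eq odds s_pr Ix Aa nta) conjIg conjGid //.
  rewrite -cent1J (cent1_inverted_eq odds s_pr Ix Aa nta).
  by rewrite (cent1_inverted_eq odds s_pr Ix Aag) // conjg_eq1.
have [->|ntg] := eqVneq g 1; first exact: group1.
have og := order_cent1_involution poG Gt ot Sg ntg.
have ag : a ^ g = a^-1.
  apply/esym/eqP; rewrite eq_invg_mul; apply/eqP.
  have Aaag : a * a ^ g \in A by rewrite groupM.
  apply/eqP/contraT => ntaag; have oaag := oA _ Aaag ntaag.
  have : #[a * a ^ g] = #[g].
    apply: (order_comm poG) => //; first by have [] := setIP Aaag.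
    apply/commgP/conjg_fixP; rewrite conjMg -conjgM (involution_mul2 og) conjg1.
    by apply: (centsP (cent1_inverted_abelian odds s_pr Ix)).
  by rewrite oaag og => e; rewrite e in odds.
have Agt : g * t \in A.
  rewrite /A -(cent1_inverted_eq odds s_pr Ix Aa nta) in_setI groupM //=.
  by apply/cent1P/commute_sym/commgP/conjg_fixP; rewrite conjgM ag conjVg At // invgK.
have Sgt : g * t \in S by rewrite groupM // in_setI Gt cent1id.
have /eqP := tiAS _ Agt Sgt; rewrite -eq_invg_mul (involution_invg og) => /eqP ->.
exact: cycle_id.
Qed.

(** If t also inverts y, then 'C_G[y] is a conjugate A^g of A = 'C_G[x], and t
    and its conjugate by g^-1 both invert A.  These two involutions differ by an
    element of A, so they are conjugate in A, and correcting g by an element of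
    A makes it commute with t. *)
Lemma inverted_class_support s x :
    odd s -> prime s -> x \in inverted s ->
  inverted s = class_support 'C_G[x]^# S.
Proof.
move=> odds s_pr Ix; set A := 'C_G[x]; have [Gx ox xt] := invertedP _ _ Ix.
have sylA : s.-Sylow(G) A := cent1_inverted_Sylow odds s_pr Ix.
have [_ sA _] := and3P sylA.
apply/setP => y; apply/idP/idP => [Iy | /imset2P[a c /setD1P[nta Aa] Sc ->]].
  have [Gy oy yt] := invertedP _ _ Iy.
  have [g Gg defCy] := Sylow_trans sylA (cent1_inverted_Sylow odds s_pr Iy).
  pose t' := t ^ g^-1.
  have t'A a : a \in A -> a ^ t' = a^-1.
    move=> Aa; have Cag : a ^ g \in 'C_G[y] by rewrite defCy memJ_conjg.
    have := cent1_inverted_invg odds s_pr Iy Cag.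
    by rewrite /t' [t ^ _]conjgE invgK mulgA !conjgM => ->; rewrite conjVg conjgK.
  have tt := involution_mul2 ot.
  have Ax : x \in A by rewrite in_setI Gx cent1id.
  have Ab : t * t' \in A.
    rewrite in_setI groupM ?groupJ ?groupV //=.
    by apply/cent1P/commute_sym/commgP/conjg_fixP; rewrite conjgM xt conjVg t'A // invgK.
  have bs1 : (t * t') ^+ s = 1.
    have [->|ntb] := eqVneq (t * t') 1; first by rewrite expg1n.
    by rewrite -(order_pgroup (prime_ordersS (subsetIl _ _) poG) sA Ab ntb) expg_order.
  (* The square root c of t t' conjugates t to t (t t') = t'. *)
  pose c := (t * t') ^+ uphalf s; have Ac : c \in A by rewrite groupX.
  have cc : c * c = t * t'.
    by rewrite -expgnDr addnn uphalfE halfK /= odds /= subn0 expgS bs1 mulg1.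
  have tc : t ^ c = t'.
    have -> : t ^ c = t * (c^-1 ^ t * c) by rewrite !conjgE !mulgA mulgV mul1g.
    by rewrite conjVg (cent1_inverted_invg odds s_pr Ix) // invgK cc mulgA tt mul1g.
  have Sd : c * g \in S.
    rewrite in_setI groupM //=; last by have [] := setIP Ac.
    by apply/cent1P/commute_sym/commgP/conjg_fixP; rewrite conjgM tc /t' conjgKV.
  have Ag : y ^ g^-1 \in A.
    by rewrite -mem_conjg -defCy in_setI Gy cent1id.
  apply/imset2P; exists (y ^ g^-1) (c * g) => //.
    by rewrite in_setD1 conjg_eq1 (nt_inverted s_pr Iy).
  have yc : (y ^ g^-1) ^ c = y ^ g^-1.
    apply/conjg_fixP/commgP.
    exact: (centsP (cent1_inverted_abelian odds s_pr Ix)).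
  by rewrite conjgM yc conjgKV.
have [Ga cxa] := setIP Aa; have [Gc cct] := setIP Sc.
apply/invertedP; split; first by rewrite groupJ.
  rewrite orderJ.
  exact: order_pgroup (prime_ordersS (subsetIl _ _) poG) sA Aa nta.
rewrite -conjgM (cent1P cct) conjgM -conjVg.
by rewrite (cent1_inverted_invg odds s_pr Ix).
Qed.

Lemma card_inverted s x :
    odd s -> prime s -> x \in inverted s ->
  (2 * #|inverted s| = (#|G|`_s - 1) * #|S|)%N.
Proof.
move=> odds s_pr Ix; rewrite (inverted_class_support odds s_pr Ix).
rewrite (card_support_normedTI (cent1_inverted_normedTI odds s_pr Ix)).
rewrite -(card_Hall (cent1_inverted_Sylow odds s_pr Ix)).
rewrite (cardsD1 1 'C_G[x]) group1 /= add1n subn1 /=.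
have st : <[t]> \subset S by rewrite cycle_subG in_setI Gt cent1id.
by rewrite -(Lagrange st) -orderE ot mulnCA.
Qed.

End InvertedElements.

(** * Counting involutions and Sylow 2-subgroups *)

Section SylowCounting.

Variables (gT : finGroupType) (G : {group gT}).
Hypothesis poG : prime_orders G.
Hypothesis ncG : forall t, t \in G -> #[t] = 2 ->
  exists2 u, u \in G :\: 'C_G[t] & #[u] = 2.
Implicit Types (t u x y z g : gT) (s : nat).

(** Two commuting involutions have the same centraliser, so an involution
    outside it is conjugate to both. *)
Lemma involutions_conj t u :
  t \in G -> u \in G -> #[t] = 2 -> #[u] = 2 -> u \in t ^: G.
Proof.
move=> Gt Gu ot ou; have [Ctu | nCtu] := boolP (u \in 'C_G[t]); last first.
  exact: (conj_noncommuting_involutions poG).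
have [v /setDP[Gv nCtv] ov] := ncG Gt ot.
have nCuv : v \notin 'C_G[u].
  by rewrite (cent1_involution_TI poG Gt ot Ctu) // involution_nt.
have /class_eqP <- := conj_noncommuting_involutions poG Gt Gv ot ov nCtv.
by rewrite class_sym; apply: (conj_noncommuting_involutions poG).
Qed.

Lemma involution_classE t u :
  t \in G -> #[t] = 2 -> (u \in t ^: G) = (u \in G) && (#[u] == 2).
Proof.
move=> Gt ot; apply/idP/andP => [/imsetP[g Gg ->]|[Gu /eqP ou]].
  by rewrite groupJ // orderJ ot.
exact: involutions_conj.
Qed.

(** The normaliser of S = 'C_G[t] permutes the involutions of S transitively,
    and t has stabiliser S: an element conjugating t to an involution u of S
    maps S to 'C_G[u] = S. *)
Lemma card_normaliser_cent1_involution t :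
  t \in G -> #[t] = 2 -> #|'N_G('C_G[t]) : 'C_G[t]| = #|'C_G[t]|.-1.
Proof.
move=> Gt ot; set S := 'C_G[t]%G; set N := 'N_G(S)%G.
have sSN : S \subset N by rewrite subsetI subsetIl normG.
have sNG : N \subset G := subsetIl _ _.
have CN : 'C_N[t] = S.
  apply/eqP; rewrite eqEsubset setSI //= subsetI sSN.
  exact: subsetIr.
rewrite -[X in #|_ : X|]CN index_cent1.
suffices -> : t ^: N = S^# by rewrite (cardsD1 1 S) group1.
apply/setP => u; rewrite in_setD1; apply/idP/andP => [/imsetP[g Ng ->]|[ntu Su]].
  have [_ nSg] := setIP Ng.
  by rewrite conjg_eq1 involution_nt // memJ_norm // in_setI Gt cent1id.
have ou := order_cent1_involution poG Gt ot Su ntu; have [Gu _] := setIP Su.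
have /imsetP[g Gg defu] := involutions_conj Gt Gu ot ou.
apply/imsetP; exists g => //; rewrite in_setI Gg; apply/normP.
rewrite /S /= conjIg conjGid // -cent1J -defu.
exact: (cent1_involution_TI poG Gt ot).
Qed.

Lemma mul_inverted s t x :
    t \in G -> #[t] = 2 -> odd s -> prime s -> x \in inverted G t s ->
  [/\ t * x \in G, #[t * x] = 2 & t * x \notin 'C_G[t]].
Proof.
move=> Gt ot odds s_pr /invertedP[Gx ox xt].
have ntx : x != 1 by rewrite -order_gt1 ox prime_gt1.
have St : t \in 'C_G[t] by rewrite in_setI Gt cent1id.
have nSx : x \notin 'C_G[t].
  by apply: contraTN odds => Sx; rewrite -ox (order_cent1_involution poG Gt ot Sx ntx).
split; [exact: groupM | apply: order_involution | by rewrite groupMl].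
  apply: contraNneq nSx => /eqP; rewrite -eq_invg_mul (involution_invg ot).
  by move/eqP <-.
move: xt; rewrite conjgE (involution_invg ot) => xt.
by rewrite mulgA -(mulgA t) xt mulVg.
Qed.

(** The index counts the involutions of G.  Those of S make up the first term;
    the others are the elements t x with x of odd order inverted by t. *)
Lemma card_index_cent1_involution p r t :
    odd p -> odd r -> p != r -> prime p -> prime r ->
    (forall x, x \in G -> x != 1 -> #[x] \in [:: 2; p; r]) ->
    t \in G -> #[t] = 2 ->
  (#|G : 'C_G[t]| = #|'C_G[t]|.-1 + #|inverted G t p| + #|inverted G t r|)%N.
Proof.
move=> oddp oddr neq_pr p_pr r_pr oG Gt ot; set S := 'C_G[t]%G.
have tt := involution_mul2 ot.
have TI : S^# \subset t ^: G.
  apply/subsetP => u /setD1P[ntu Su]; rewrite involution_classE //.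
  by rewrite (order_cent1_involution poG Gt ot Su ntu) (subsetP (subsetIl _ _) u Su).
have invI s x : odd s -> prime s -> x \in inverted G t s -> t * x \in t ^: G :\: S^#.
  move=> odds s_pr Ix; have [Gtx otx nStx] := mul_inverted Gt ot odds s_pr Ix.
  by rewrite in_setD in_setD1 (negPf nStx) andbF involution_classE // Gtx otx.
have defI : t ^: G :\: S^# = t *: (inverted G t p :|: inverted G t r).
  apply/setP => u; apply/idP/idP => [|/lcosetP[x /setUP[] Ix ->]]; last 2 first.
  - exact: invI Ix.
  - exact: invI Ix.
  rewrite in_setD in_setD1 negb_and negbK involution_classE //.
  case/and3P => nSu Gu /eqP ou.
  have {nSu} nSu : u \notin S by case/predU1P: nSu => // u1; rewrite u1 order1 in ou.
  rewrite mem_lcoset (involution_invg ot).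
  have Gtu : t * u \in G by rewrite groupM.
  have tut : (t * u) ^ t = (t * u)^-1.
    by rewrite conjgE invMg !involution_invg // !mulgA tt mul1g.
  have nttu : t * u != 1.
    apply: contraNneq nSu => /eqP; rewrite -eq_invg_mul (involution_invg ot).
    by move/eqP <-; rewrite in_setI Gt cent1id.
  have otu : #[t * u] != 2.
    apply: contraNneq nSu => otu; rewrite in_setI Gu; apply/cent1P.
    by move: (involution_invg otu); rewrite invMg !involution_invg.
  have := oG _ Gtu nttu; rewrite !in_cons (negPf otu) /= orbF in_setU.
  by case/orP => /eqP o; apply/orP; [left | right]; apply/invertedP.
rewrite index_cent1 -(cardsID S^# (t ^: G)) (setIidPr TI) defI card_lcoset cardsU.
have -> : inverted G t p :&: inverted G t r = set0.
  apply/setP => x; rewrite !inE; apply: contraNF neq_pr.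
  by case/andP => /and3P[_ /eqP <- _] /and3P[_ /eqP <- _].
by rewrite cards0 subn0 (cardsD1 1 S) group1 addnA.
Qed.

(** For x of order 3 inverted by t, the involution s = t x satisfies the braid
    relation t s t = s t s.  If two such involutions s1 and s2 commute, then
    w = t s1 s2 t satisfies s1 w = w s2 and s2 w = w s1, so w commutes with
    s1 s2; if s1 != s2 then w lies in the abelian group 'C_G[s1 s2] = 'C_G[s1],
    commutes with s1, and s1 = s2 after all.  Hence the map from x to the Sylow
    2-subgroup 'C_G[t x] is injective, and it misses 'C_G[t]. *)
Lemma card_inverted3_bound t :
  t \in G -> #[t] = 2 -> (#|inverted G t 3| < #|'Syl_2(G)|)%N.
Proof.
move=> Gt ot; set S := 'C_G[t]%G; have tt := involution_mul2 ot.
have odd3 := isT : odd 3; have pr3 := isT : prime 3.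
pose f x := 'C_G[t * x]%G.
have f_inj : {in inverted G t 3 &, injective f}.
  move=> x1 x2 I1 I2 /(congr1 val) /= eqf.
  have [G1 o1 _] := mul_inverted Gt ot odd3 pr3 I1.
  have [G2 o2 _] := mul_inverted Gt ot odd3 pr3 I2.
  have braid x : x \in inverted G t 3 -> t * (t * x) * t = (t * x) * t * (t * x).
    case/invertedP => _ ox; rewrite conjgE (involution_invg ot) => xt.
    have xx : x^-1 = x * x.
      by apply/eqP; rewrite eq_invg_mul -expg2 -expgS -ox expg_order.
    have xt' : x * t = t * (x * x) by rewrite -xx -xt mulgA tt mul1g.
    by rewrite -[RHS]mulgA [t * (t * x)]mulgA tt mul1g xt' mulgA.
  have {braid} := (braid x1 I1, braid x2 I2).
  set s1 := t * x1 in o1 G1 eqf *; set s2 := t * x2 in o2 G2 eqf *.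
  move=> [b1 b2]; apply: (mulgI t); rewrite -/s1 -/s2.
  clearbody s1 s2; apply/eqP/contraT => neq.
  have C2 : s2 \in 'C_G[s1] by rewrite eqf in_setI G2 cent1id.
  have c12 : s1 * s2 = s2 * s1 by have [_ /cent1P] := setIP C2.
  have mulw a b : t * a * t = a * t * a -> t * b * t = b * t * b ->
      t * (a * b) * t = a * (t * (a * b) * t) * b.
    move=> ba bb; rewrite [LHS](_ : _ = (t * a * t) * (t * b * t)).
      by rewrite ba bb !mulgA.
    by rewrite !mulgA -(mulgA _ t t) tt mulg1.
  have [w defw] : {w | w = t * (s1 * s2) * t} by exists (t * (s1 * s2) * t).
  have w1 : s1 * w = w * s2.
    by rewrite [in LHS]defw mulw // -defw !mulgA (involution_mul2 o1) mul1g.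
  have w2 : s2 * w = w * s1.
    rewrite [in LHS]defw c12 mulw // -c12 -defw.
    by rewrite !mulgA (involution_mul2 o2) mul1g.
  have Gw : w \in G by rewrite defw !groupM.
  have nts12 : s1 * s2 != 1.
    apply: contraNneq neq => /eqP; rewrite -eq_invg_mul (involution_invg o1).
    by move/eqP ->.
  have C12 : s1 * s2 \in 'C_G[s1] by rewrite groupM // in_setI G1 cent1id.
  have : w \in 'C_G[s1 * s2].
    rewrite in_setI Gw; apply/cent1P.
    by rewrite /commute -[RHS]mulgA w2 [RHS]mulgA w1 -[RHS]mulgA -c12.
  rewrite (cent1_involution_TI poG G1 o1 C12 nts12) => /setIP[_ /cent1P cws1].
  by case/eqP: neq; apply: (mulIg w); rewrite w2.
rewrite -(card_in_imset f_inj); apply: proper_card.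
apply/properP; split.
  apply/subsetP => _ /imsetP[x Ix ->]; rewrite inE.
  have [Gtx otx _] := mul_inverted Gt ot odd3 pr3 Ix.
  exact: cent1_involution_Sylow.
exists S; first by rewrite inE; apply: cent1_involution_Sylow.
apply/imsetP => -[x Ix /(congr1 val) /= eqS].
have [Gtx otx] := mul_inverted Gt ot odd3 pr3 Ix.
by rewrite eqS in_setI Gtx cent1id.
Qed.

End SylowCounting.

(** * The order of the group *)

(** Here q = 2 h, p = q - 1, and cp and cr count the elements of order p and r
    inverted by t.  Modulo p the equation reads 0 = cp + cr, and h is prime to
    p.  If both vanish then nr = 1; if only cr does, p divides np - 1; if only cp
    does, nr is 1 modulo p but too small.  If neither does, nr = 2 + k p and
    np = m p for some k and m, and substituting p = 2 h - 1 leaves only k = m = 1. *)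
Lemma sylow_orders_arith h p np nr cp cr :
    (1 < h)%N -> (p = 2 * h - 1)%N -> prime p -> (p %| np)%N ->
    (1 < np)%N -> (1 < nr)%N ->
    (np * nr = p + cp + cr)%N ->
    cp = 0 \/ cp = ((np - 1) * h)%N -> cr = 0 \/ cr = ((nr - 1) * h)%N ->
  [/\ np = p, nr = p.+2 & cr = ((nr - 1) * h)%N].
Proof.
move=> h1 def_p p_pr /dvdnP[m def_np] np1 nr1 eqn.
have p_gt0 := prime_gt0 p_pr.
have m0 : (0 < m)%N by case: m def_np => // e; rewrite e in np1.
have ltph : (h < p)%N by lia.
have nph : ~~ (p %| h)%N by rewrite gtnNdvd; lia.
have divh k : (p %| k * h)%N -> (p %| k)%N by rewrite Euclid_dvdM // (negPf nph) orbF.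
have def_m : (np * nr = m * nr * p)%N by rewrite def_np mulnAC.
have dvd_c k : (np * nr = p + k)%N -> (p %| k)%N.
  by move=> e; rewrite -(dvdn_addr k (dvdnn p)) -e def_m dvdn_mull.
have cancel_p a b : (a * p = b * p)%N -> a = b.
  by move/eqP; rewrite eqn_pmul2r // => /eqP.
case=> ecp [] ecr; rewrite ecp ecr ?addn0 in eqn.
- have /eqP : (m * nr = 1)%N by apply: cancel_p; rewrite -def_m mul1n.
  by rewrite muln_eq1 => /andP[_ /eqP e]; rewrite e in nr1.
- have /dvdnP[k def_nr] := divh _ (dvd_c _ eqn).
  have k0 : (0 < k)%N by case: k def_nr => // e; lia.
  have e : (m * nr = 1 + k * h)%N.
    by apply: cancel_p; rewrite -def_m eqn def_nr; lia.
  have : (nr <= m * nr)%N by rewrite leq_pmull.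
  have : (k * h < k * p)%N by rewrite ltn_pmul2l.
  lia.
- have /dvdnP[k def_np1] := divh _ (dvd_c _ eqn).
  have : (p %| np - (np - 1))%N by rewrite dvdn_sub // ?def_np1 ?def_np dvdn_mull.
  by rewrite subKn 1?ltnW // dvdn1 => /eqP p1; rewrite p1 in p_pr.
have eqn' : (np * nr = p + (np + (nr - 2)) * h)%N.
  by rewrite eqn -addnA -mulnDl; congr (_ + _ * _)%N; lia.
have : (p %| (nr - 2))%N.
  have := divh _ (dvd_c _ eqn'); rewrite dvdn_addr //.
  by rewrite def_np dvdn_mull.
case/dvdnP => k def_nr2; have def_nr : (nr = 2 + k * p)%N by lia.
have key : (m * nr = 1 + (m + k) * h)%N.
  by apply: cancel_p; rewrite -def_m eqn' def_nr2 {1}def_np; lia.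
have k0 : (0 < k)%N.
  case: k def_nr2 def_nr key => // _ -> e; exfalso.
  have : (m * 2 <= m * h)%N by rewrite leq_mul2l h1 orbT.
  lia.
have [m1 k1] : m = 1%N /\ k = 1%N.
  case: m k h {def_np def_m eqn eqn' divh dvd_c nph def_nr2 ecp ecr}
    m0 k0 h1 def_p ltph def_nr key
    => [|a] [|b] [|[|g]] //= _ _ _ -> _ -> key.
  (* With m = a + 1, k = b + 1 and h = g + 2, this is the equation [key]. *)
  have : ((2 * g + 3) * a * b + (g + 3) * a + (g + 1) * b = 0)%N by lia.
  move/eqP; rewrite !addn_eq0 !muln_eq0 => /andP[/andP[_ Ha] Hb].
  by split; lia.
by rewrite m1 mul1n in def_np; rewrite k1 mul1n in def_nr; split=> //; rewrite def_nr.
Qed.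

Section OrderSixty.

Variables (gT : finGroupType) (G : {group gT}).
Hypotheses (poG : prime_orders G) (nsolG : ~~ solvable G).
Implicit Types (t u x y z g : gT) (p r : nat).

Lemma card_three_primes p r :
  primes #|G| = [:: 2; p; r] -> #|G| = (#|G|`_2 * (#|G|`_p * #|G|`_r))%N.
Proof.
move=> piG; rewrite {1}(prod_prime_decomp (cardG_gt0 G)) prime_decompE piG /=.
by rewrite !big_cons big_nil /= !p_part muln1.
Qed.

Lemma order_in_primes x : x \in G -> x != 1 -> #[x] \in primes #|G|.
Proof.
by move=> Gx ntx; rewrite mem_primes poG // cardG_gt0 order_dvdG.
Qed.

(** The quotient by S has order divisible by at most two primes. *)
Lemma normal_Sylow2_solvable p r (N S : {group gT}) :
    primes #|G| = [:: 2; p; r] -> N \subset G -> S <| N -> 2.-Sylow(N) S ->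
  solvable N.
Proof.
move=> piG sNG nsSN sylS; have [sSN pS p'S] := and3P sylS.
rewrite (series_sol nsSN) (pgroup_sol pS) /=.
apply: integral_char.Burnside_p_a_q_b.
apply: (@uniq_leq_size _ _ [:: p; r]); first exact: primes_uniq.
move=> q; rewrite card_quotient ?normal_norm // => piq.
have: q \in primes #|G|.
  by apply: pi_of_dvd piq; rewrite // (dvdn_trans (dvdn_indexg _ _)) ?cardSg.
rewrite piG in_cons => /predU1P[q2|//].
move: piq; rewrite q2 mem_primes => /and3P[_ _ d2].
by have := pnatP _ (indexg_gt0 _ _) p'S 2 isT d2.
Qed.

(** Otherwise 'C_G[t] contains all involutions, so it is a normal Sylow
    2-subgroup. *)
Lemma involutions_not_centralised p r : primes #|G| = [:: 2; p; r] ->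
  forall t, t \in G -> #[t] = 2 -> exists2 u, u \in G :\: 'C_G[t] & #[u] = 2.
Proof.
move=> piG t Gt ot; set S := 'C_G[t]%G.
have [/exists_inP[u Gu /eqP ou]|] := boolP [exists u in G :\: S, #[u] == 2].
  by exists u.
rewrite negb_exists_in => /forall_inP allS; case/negP: nsolG.
have sSG : S \subset G := subsetIl _ _.
have nsSG : S <| G.
  rewrite /normal sSG; apply/subsetP => g Gg; apply/normP.
  have otg : #[t ^ g] = 2 by rewrite orderJ.
  have Stg : t ^ g \in S.
    apply/contraT => nS; have := allS (t ^ g).
    by rewrite in_setD nS groupJ // otg => /(_ isT).
  rewrite /S /= conjIg conjGid // -cent1J.
  by apply: (cent1_involution_TI poG Gt ot Stg); rewrite involution_nt.
have sylS : 2.-Sylow(G) S := cent1_involution_Sylow poG Gt ot.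
exact: normal_Sylow2_solvable piG (subxx _) nsSG sylS.
Qed.

Lemma normaliser_index_prime p r t :
    primes #|G| = [:: 2; p; r] -> t \in G -> #[t] = 2 ->
  #|'C_G[t]|.-1 = 1%N \/ prime #|'C_G[t]|.-1.
Proof.
move=> piG Gt ot; have ncG := involutions_not_centralised piG.
set S := 'C_G[t]%G; set N := 'N_G(S)%G.
have oNS : #|N : S| = #|S|.-1 := card_normaliser_cent1_involution poG ncG Gt ot.
have sSG : S \subset G := subsetIl _ _.
have sSN : S \subset N by rewrite subsetI sSG normG.
have sNG : N \subset G := subsetIl _ _.
have nsSN : S <| N by apply: normalSG.
have sylS : 2.-Sylow(G) S := cent1_involution_Sylow poG Gt ot.
have sylSN := pHall_subl sSN sNG sylS.
have [_ pS _] := and3P sylSN.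
have solN := normal_Sylow2_solvable piG sNG nsSN sylSN.
have ntS : S :!=: 1.
  by apply/trivgPn; exists t; rewrite ?involution_nt // in_setI Gt cent1id.
have [sylF idx] := Fitting_Sylow solN (prime_ordersS sNG poG) nsSN ntS pS.
have defF : 'F(N) = S.
  apply: (sub_pHall sylSN); first by have [] := and3P sylF.
    by rewrite Fitting_max ?(pgroup_nil pS).
  exact: Fitting_sub.
rewrite -oNS; move: idx; rewrite defF => -[eqSN|]; [left | by right].
by rewrite -[X in #|X : _|]eqSN indexgg.
Qed.

(** The primes p and r play symmetric roles until one of them is found to be
    q - 1; p stands for that one. *)
Lemma order_sixty_aux p r t :
    primes #|G| =i [:: 2; p; r] -> #|G| = (#|G|`_2 * (#|G|`_p * #|G|`_r))%N ->
    (forall u, u \in G -> #[u] = 2 -> exists2 v, v \in G :\: 'C_G[u] & #[v] = 2) ->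
    odd p -> odd r -> p != r -> t \in G -> #[t] = 2 ->
    #|'C_G[t]|.-1 = 1%N \/ #|'C_G[t]|.-1 = p ->
  #|'C_G[t]| = 4 /\ #|G| = 60.
Proof.
move=> piG oG ncG oddp oddr neq_pr Gt ot def_p.
set S := 'C_G[t]%G in def_p *.
have sylS : 2.-Sylow(G) S := cent1_involution_Sylow poG Gt ot.
have oS : (#|S| = #|G|`_2)%N := card_Hall sylS.
have sSG : S \subset G := subsetIl _ _.
have pr_of s : s \in [:: 2; p; r] -> prime s.
  by rewrite -piG mem_primes => /and3P[].
have p_pr : prime p by rewrite pr_of // !inE eqxx orbT.
have r_pr : prime r by rewrite pr_of // !inE eqxx !orbT.
have np1 : (1 < #|G|`_p)%N by rewrite p_part_gt1 piG !inE eqxx orbT.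
have nr1 : (1 < #|G|`_r)%N by rewrite p_part_gt1 piG !inE eqxx !orbT.
have oidx : #|G : S| = (#|G|`_p * #|G|`_r)%N.
  by apply/eqP; rewrite -(eqn_pmul2l (cardG_gt0 S)) Lagrange // oS -oG.
have evenS : (2 %| #|S|)%N by rewrite -ot order_dvdG // in_setI Gt cent1id.
have [h def_q] : exists h, #|S| = (2 * h)%N.
  by case/dvdnP: evenS => h ->; exists h; rewrite mulnC.
have card_inv s : odd s -> prime s ->
    #|inverted G t s| = 0%N \/ #|inverted G t s| = ((#|G|`_s - 1) * h)%N.
  move=> odds s_pr; have [->|[x Ix]] := set_0Vmem (inverted G t s).
    by left; rewrite cards0.
  right; have := card_inverted poG Gt ot odds s_pr Ix.
  by rewrite -/S def_q mulnCA; move/eqP; rewrite eqn_pmul2l // => /eqP.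
have eqn : (#|G|`_p * #|G|`_r
            = #|S|.-1 + #|inverted G t p| + #|inverted G t r|)%N.
  rewrite -oidx.
  apply: (card_index_cent1_involution poG ncG oddp oddr neq_pr p_pr r_pr) => //.
  by move=> x Gx ntx; rewrite -piG order_in_primes.
have {def_p} def_p : #|S|.-1 = p.
  case: def_p => // q1; have h1 : h = 1%N by move: q1; rewrite [#|_|]def_q; lia.
  move: eqn (card_inv p oddp p_pr) (card_inv r oddr r_pr); rewrite q1 h1 !muln1.
  move: (#|G|`_p)%N (#|G|`_r)%N np1 nr1 => m n m1 n1 e cp cr.
  (* For q = 2 the equation would give m n <= m + n - 1, that is,
     (m - 1) (n - 1) <= 0. *)
  case: m n m1 n1 e cp cr => [|m] [|n] //; rewrite !subn1 /= !ltnS => m0 n0 e cp cr.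
  by have : (0 < m * n)%N; [rewrite muln_gt0 m0 | lia].
rewrite def_p in eqn; have p_gt1 := prime_gt1 p_pr.
have dvd_p : (p %| #|G|`_p)%N.
  by rewrite p_part dvdn_exp // logn_gt0 piG !inE eqxx orbT.
have h1 : (1 < h)%N by move: p_gt1; rewrite -def_p def_q; clear; lia.
have def_p' : (p = 2 * h - 1)%N by rewrite -def_p def_q subn1.
have [enp enr ecr] := sylow_orders_arith h1 def_p' p_pr dvd_p np1 nr1 eqn
   (card_inv p oddp p_pr) (card_inv r oddr r_pr).
have nq3 : ~~ (3 %| #|S|)%N.
  have [_ pS _] := and3P sylS; apply/negP => d3.
  by have := pnatP _ (cardG_gt0 S) pS 3 isT d3.
have [q3|nq3'] := boolP (3 %| p)%N.
  have p3 : p = 3 by apply/eqP; rewrite eq_sym -dvdn_prime2.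
  have oS4 : #|S| = 4 by rewrite def_q; clear -p3 def_p' h1; lia.
  by rewrite oG -oS enp enr p3 oS4.
(* 3 divides neither q nor q - 1, so it divides n_r = q + 1, a power of r. *)
have r3 : r = 3.
  have : (3 %| #|G|`_r)%N.
    by rewrite enr; move: nq3 nq3'; rewrite def_q def_p'; clear -h1; lia.
  by rewrite p_part Euclid_dvdX // dvdn_prime2 // => /andP[/eqP].
exfalso; have := card_inverted3_bound poG Gt ot.
have sSN : S \subset 'N_G(S) by rewrite subsetI sSG normG.
have oSyl : #|G : 'N_G(S)| = p.+2.
  apply/eqP; rewrite -(eqn_pmul2r (prime_gt0 p_pr)) -{1}def_p.
  rewrite -(card_normaliser_cent1_involution poG ncG Gt ot) -/S.
  by rewrite Lagrange_index ?subsetIl // oidx enp enr mulnC.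
rewrite (card_Syl sylS) oSyl -r3 ecr enr.
have -> : (p.+2 - 1 = 2 * h)%N by clear -def_p' h1; lia.
have : (2 * h * 2 <= 2 * h * h)%N by rewrite leq_mul2l h1 orbT.
by clear -def_p' h1; lia.
Qed.

Lemma order_sixty p r t :
    primes #|G| = [:: 2; p; r] -> t \in G -> #[t] = 2 ->
  #|'C_G[t]| = 4 /\ #|G| = 60.
Proof.
move=> piG Gt ot; have ncG := involutions_not_centralised piG.
have pr_of s : s \in [:: 2; p; r] -> prime s.
  by rewrite -piG mem_primes => /and3P[].
have := primes_uniq #|G|; rewrite piG /= !in_cons !in_nil !orbF negb_or andbT.
case/andP => /andP[p2 r2] neq_pr.
have odd_of s : s \in [:: 2; p; r] -> 2 != s -> odd s.
  by move/pr_of/even_prime => [->|].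
have oddp : odd p by rewrite odd_of // !inE eqxx orbT.
have oddr : odd r by rewrite odd_of // !inE eqxx !orbT.
have oG := card_three_primes piG.
set S := 'C_G[t]%G; have sSG : S \subset G := subsetIl _ _.
have aux_pr : #|S|.-1 = 1%N \/ #|S|.-1 = p -> #|S| = 4 /\ #|G| = 60.
  by apply: (@order_sixty_aux p r); rewrite ?piG.
have aux_rp : #|S|.-1 = 1%N \/ #|S|.-1 = r -> #|S| = 4 /\ #|G| = 60.
  apply: (@order_sixty_aux r p) => //; last by rewrite eq_sym.
    by move=> s; rewrite piG !inE [(s == r) || _]orbC.
  by rewrite [X in (_ * X)%N]mulnC.
have [q1|q_pr] := normaliser_index_prime piG Gt ot; first by apply: aux_pr; left.
have : #|S|.-1 \in primes #|G|.
  rewrite mem_primes q_pr cardG_gt0 -/S.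
  rewrite -(card_normaliser_cent1_involution poG ncG Gt ot) -/S.
  by rewrite (dvdn_trans (dvdn_indexg _ _)) // cardSg // subsetIl.
rewrite piG !inE => /or3P[] /eqP e; last 2 first.
- by apply: aux_pr; right.
- by apply: aux_rp; right.
have : (2 %| #|S|)%N by rewrite -ot order_dvdG // in_setI Gt cent1id.
by move: e (cardG_gt0 S); lia.
Qed.

End OrderSixty.

(** * Groups of order 60 *)

Section ConjugationAction.

Variables (gT : finGroupType) (G : {group gT}) (A : {set {group gT}}).
Hypothesis JA : forall g P, g \in G -> P \in A -> (P :^ g)%G \in A.

(** Numbering A by 'I_n makes the images elements of a fixed symmetric group,
    where the alternating group can be compared with them. *)
Lemma conj_perm_rep n : #|A| = n ->
  exists f : {morphism G >-> {perm 'I_n}},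
    forall g P, g \in G -> f g = 1 -> P \in A -> g \in 'N(P).
Proof.
move=> oA; subst n.
(* The permutation must be defined for all g in gT; outside G it is the identity. *)
pose h (g : gT) := if g \in G then g else 1.
have hG g : h g \in G by rewrite /h; case: ifP.
have hE g : g \in G -> h g = g by rewrite /h => ->.
have Ae (i : 'I_#|A|) : enum_val i \in A by apply: enum_valP.
pose F g (i : 'I_#|A|) := enum_rank_in (Ae i) (enum_val i :^ h g)%G.
have FE g i : enum_val (F g i) = (enum_val i :^ h g)%G.
  by rewrite enum_rankK_in // JA.
have F_inj g : injective (F g).
  move=> i j /(congr1 enum_val); rewrite !FE => /(congr1 val) /= e.
  by apply/enum_val_inj/val_inj; apply: (conjsg_inj (x := h g)).
pose f g := perm (F_inj g).
have fM : {in G &, {morph f : x y / x * y}}.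
  move=> x y Gx Gy; apply/permP => i; rewrite permM !permE.
  apply/enum_val_inj/val_inj; rewrite !FE /= !hE ?groupM //.
  by rewrite conjsgM.
exists (Morphism fM) => g P Gg fg1 AP; apply/normP.
have := FE g (enum_rank_in AP P); rewrite enum_rankK_in // hE // => /(congr1 val) /= <-.
by rewrite -[F _ _](permE (F_inj g)) [perm _]fg1 perm1 enum_rankK_in.
Qed.

End ConjugationAction.

(** G acts by conjugation on its 5 Sylow 2-subgroups.  An element g of the kernel
    is not an involution, as a 2-element normalising a Sylow 2-subgroup lies in
    it; and [g, t] lies in S and in the kernel, so it is trivial, g commutes with
    t, and g = 1.  The image is even: elements of odd order are squares, and all
    involutions have the same sign, which is the sign of a product of two of
    them.  So the image is the whole alternating group, also of order 60. *)
Lemma isog_Alt5_of_order_sixty (gT : finGroupType) (G : {group gT}) t :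
    prime_orders G ->
    (forall u, u \in G -> #[u] = 2 -> exists2 v, v \in G :\: 'C_G[u] & #[v] = 2) ->
    t \in G -> #[t] = 2 -> #|'C_G[t]| = 4 -> #|G| = 60 ->
  G \isog 'Alt_('I_5).
Proof.
move=> poG ncG Gt ot oS oG; set S := 'C_G[t]%G.
have sylS : 2.-Sylow(G) S := cent1_involution_Sylow poG Gt ot.
have [sSG pS _] := and3P sylS.
have oSyl : #|'Syl_2(G)| = 5.
  have sSN : S \subset 'N_G(S) by rewrite subsetI sSG normG.
  have oNS : #|'N_G(S) : S| = 3.
    by rewrite (card_normaliser_cent1_involution poG ncG Gt ot) oS.
  have := Lagrange sSG; rewrite [#|S|]oS oG (card_Syl sylS).
  by rewrite -(Lagrange_index (subsetIl _ _) sSN) oNS /=; lia.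
have JSyl g (P : {group gT}) : g \in G -> P \in 'Syl_2(G) -> (P :^ g)%G \in 'Syl_2(G).
  by move=> Gg; rewrite !inE pHallJ.
have [f kerf] := conj_perm_rep JSyl oSyl.
have kerf2 g : g \in G -> f g = 1 -> #[g] != 2.
  move=> Gg fg1; apply/eqP => og; have [u /setDP[Gu nCu] ou] := ncG g Gg og.
  have sylCu := cent1_involution_Sylow poG Gu ou.
  have Ng : g \in 'N_G('C_G[u]).
    by rewrite in_setI Gg (kerf g 'C_G[u]%G) // inE.
  have sylN := pHall_subl (_ : 'C_G[u] \subset 'N_G('C_G[u])) (subsetIl _ _) sylCu.
  have sCN : 'C_G[u] \subset 'N_G('C_G[u]) by rewrite subsetI subsetIl normG.
  have Cg : g \in 'C_G[u].
    rewrite (mem_normal_Hall (sylN sCN)) ?normalSG ?subsetIl //.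
    by rewrite /p_elt og.
  case/negP: nCu; rewrite in_setI Gu cent1C.
  by have [] := setIP Cg.
have injf : 'injm f.
  apply/subsetP => g /morphpreP[Gg /set1gP fg1]; apply/set1gP/eqP/contraT => ntg.
  have Ng : g \in 'N(S) by apply: kerf; rewrite ?inE.
  have St : t \in S by rewrite in_setI Gt cent1id.
  have com1 : [~ g, t] = 1.
    have Gc : [~ g, t] \in G by rewrite groupR.
    have fc : f [~ g, t] = 1 by rewrite morphR // fg1 comm1g.
    apply/eqP/contraT => ntc; case/negP: (kerf2 _ Gc fc).
    rewrite (order_cent1_involution poG Gt ot _ ntc) //.
    by rewrite commgEr groupM // memJ_norm ?groupV.
  case/negP: (kerf2 g Gg fg1).
  have cgt : commute g t by apply/commgP/eqP.
  by rewrite (order_comm poG Gg Gt ntg (involution_nt ot) cgt) ot.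
have even_inv u : u \in G -> #[u] = 2 -> odd_perm (f u) = false.
  have class_odd v w : v \in G -> w \in G -> #[v] = 2 -> #[w] = 2 ->
      odd_perm (f v) = odd_perm (f w).
    move=> Gv Gw ov ow; have /imsetP[g Gg ->] := involutions_conj poG ncG Gv Gw ov ow.
    by rewrite morphJ // odd_permJ.
  move=> Gu ou; rewrite (class_odd u t) //.
  have St : t \in S by rewrite in_setI Gt cent1id.
  have /subsetPn[v Sv] : ~~ (S \subset [set 1; t]).
    apply/negP => /subset_leq_card; rewrite [#|S|]oS cards2.
    by case: (_ != _).
  rewrite !inE negb_or => /andP[ntv neqvt].
  have ov := order_cent1_involution poG Gt ot Sv ntv; have Gv := subsetP sSG v Sv.
  have nttv : t * v != 1.
    by rewrite -eq_invg_mul (involution_invg ot) eq_sym.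
  have otv := order_cent1_involution poG Gt ot (groupM St Sv) nttv.
  rewrite (class_odd t (t * v)) ?groupM // morphM // odd_permM.
  by rewrite (class_odd v t) // addbb.
have sfA : f @* G \subset 'Alt_('I_5).
  apply/subsetP => _ /morphimP[x _ Gx ->]; rewrite Alt_even.
  have [->|ntx] := eqVneq x 1; first by rewrite morph1 odd_perm1.
  case: (even_prime (poG x Gx ntx)) => [o2|oddx]; first by rewrite even_inv.
  have <- : (x ^+ uphalf #[x]) ^+ 2 = x.
    by rewrite -expgM muln2 uphalfE halfK /= oddx subn0 expgS expg_order mulg1.
  by rewrite morphX ?groupX // expgS odd_permM addbb.
have -> : 'Alt_('I_5) = f @* G.
  apply/esym/eqP; rewrite eqEcard sfA card_injm // oG.
  have := @card_Alt 'I_5; rewrite card_ord => /(_ isT) e.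
  by rewrite -(leq_pmul2l (isT : 0 < 2)%N) e.
exact: sub_isog.
Qed.

(** * Element orders of the alternating group *)

Lemma expg_card_porbit_eq1 (T : finType) (x : {perm T}) n :
  (forall i, #|porbit x i| %| n)%N -> x ^+ n = 1.
Proof.
move=> dvd; apply/permP => i; rewrite perm1; have /dvdnP[k ->] := dvd i.
elim: k => [|k IHk]; first by rewrite mul0n perm1.
by rewrite mulSn expgnDr permM [(x ^+ #|_|) i]permX iter_porbit IHk.
Qed.

(** An even permutation of 5 points has 1, 3 or 5 cycles.  With 5 cycles it is
    the identity; with 1 it is a 5-cycle; with 3, either all cycles have length
    at most 2, or one has length 3 and the other two have length 1. *)
Lemma order_Alt5 x : x \in 'Alt_('I_5) -> #[x] \in [:: 1; 2; 3; 5]%N.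
Proof.
rewrite Alt_even /odd_perm card_ord /= => odd_orb.
have orb1 (O : {set 'I_5}) : O \in porbits x -> (0 < #|O|)%N.
  by case/imsetP => i _ ->; rewrite card_gt0; apply/set0Pn; exists i; apply: porbit_id.
have sum_orb : (\sum_(O in porbits x) #|O| = 5)%N.
  have part : partition (porbits x) [set: 'I_5].
    have -> : porbits x = orbit 'P <[x]> @: setT.
      by apply/setP => O; apply/imsetP/imsetP => -[i _ ->]; exists i; rewrite ?porbitE.
    by apply: orbit_partition; apply/actsP => a _ i; rewrite !inE.
  by rewrite -(card_partition part) cardsT card_ord.
have ge_card (A : {set {set 'I_5}}) : {subset A <= porbits x} ->
    (#|A| <= \sum_(O in A) #|O|)%N.
  by move=> sA; rewrite -sum1_card leq_sum // => O /sA/orb1.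
pose m i := #|porbit x i|.
have orb i : porbit x i \in porbits x by apply: imset_f.
(* Every cycle other than the given ones has length at least 1. *)
have max1 i : (m i + #|porbits x| <= 6)%N.
  have e := sum_orb; rewrite (big_setD1 _ (orb i)) /= -/(m i) in e.
  rewrite (cardsD1 (porbit x i)) orb addnCA add1n ltnS -[X in (_ <= X)%N]e leq_add2l.
  exact: ge_card (subsetP (subsetDl _ _)).
have max2 i j : porbit x i != porbit x j -> (m i + m j + #|porbits x| <= 7)%N.
  move=> neq; have orbj : porbit x j \in porbits x :\ porbit x i.
    by rewrite in_setD1 eq_sym neq orb.
  have e := sum_orb; rewrite (big_setD1 _ (orb i)) (big_setD1 _ orbj) /= in e.
  rewrite (cardsD1 (porbit x i)) orb (cardsD1 (porbit x j)) orbj.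
  rewrite -addnA 2![(m j + _)%N]addnCA 2![(m i + _)%N]addnCA !add1n !ltnS.
  rewrite -[X in (_ <= X)%N]e !leq_add2l.
  exact: ge_card (subsetP (subset_trans (subsetDl _ _) (subsetDl _ _))).
have n_le5 : (#|porbits x| <= 5)%N.
  by have := ge_card (porbits x) (fun _ => id); rewrite sum_orb.
have m_gt0 i : (0 < m i)%N by apply: orb1.
have dvd_prime p : prime p -> x ^+ p = 1 -> #[x] \in [:: 1%N; p].
  move=> p_pr /eqP; rewrite -order_dvdn !inE orbC.
  by case/primeP: p_pr => _ h /h; rewrite orbC.
have xn1 n : (forall i, m i %| n)%N -> x ^+ n = 1 := @expg_card_porbit_eq1 _ x n.
have [n5 | n3 | n1] : [\/ #|porbits x| = 5, #|porbits x| = 3 | #|porbits x| = 1]%N.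
- case: #|porbits x| odd_orb n_le5 => [|[|[|[|[|[|n]]]]]] // _ _.
  + exact: Or33.
  + exact: Or32.
  + exact: Or31.
- suffices -> : x = 1 by rewrite order1.
  rewrite -[x]expg1; apply: xn1 => i; rewrite dvdn1 eqn_leq m_gt0 andbT.
  by have := max1 i; rewrite n5; lia.
- have [/existsP[i mi]|] := boolP [exists i, 2 < m i].
    suffices /dvd_prime : x ^+ 3 = 1.
      by rewrite !inE => /(_ isT)/orP[]->; rewrite ?orbT.
    apply: xn1 => j; have mi3 : m i = 3 by have := max1 i; lia.
    have [eqij|neqij] := eqVneq (porbit x i) (porbit x j).
      by rewrite /m -eqij [#|_|]mi3.
    suffices -> : m j = 1%N by [].
    by have := max2 i j neqij; have := m_gt0 j; lia.
  rewrite negb_exists => /forallP m_le2.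
  suffices /dvd_prime : x ^+ 2 = 1.
    by rewrite !inE => /(_ isT)/orP[]->; rewrite ?orbT.
  apply: xn1 => i; have := m_le2 i; have := m_gt0 i.
  by case: (m i) => [|[|[|]]].
suffices /dvd_prime : x ^+ 5 = 1.
  by rewrite !inE => /(_ isT)/orP[]->; rewrite ?orbT.
have /cards1P[O defO] : #|porbits x| == 1%N by rewrite n1.
apply: xn1 => i; suffices -> : m i = 5 by [].
by have := orb i; move: sum_orb; rewrite /m defO big_set1 => e /set1P ->.
Qed.

Lemma eta_Alt5 : eta 'Alt_('I_5) = 4.
Proof.
have oA : #|'Alt_('I_5)| = 60.
  by have := @card_Alt 'I_5; rewrite card_ord => /(_ isT); rewrite !factS fact0; lia.
have -> : 4 = size [:: 1; 2; 3; 5]%N by [].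
apply/perm_size/uniq_perm; rewrite ?undup_uniq // => n; rewrite mem_undup.
apply/imageP/idP => [[x Ax ->]|]; first exact: order_Alt5.
rewrite in_cons => /predU1P[->|n_in]; first by exists 1; rewrite ?group1 ?order1.
have /andP[n_pr n_dv] : prime n && (n %| 60)%N.
  by move: n_in; rewrite !inE => /or3P[] /eqP->.
have [|x Ax ox] := Cauchy n_pr (_ : n %| #|'Alt_('I_5)|)%N; first by rewrite oA.
by exists x; rewrite ?ox.
Qed.

(** * Groups with four element orders *)

Section EtaFour.

Variables (gT : finGroupType) (G : {group gT}).
Hypotheses (nsolG : ~~ solvable G) (etaG : eta G = 4).

Lemma mem_omega n : (n \in omega G) = [exists x in G, #[x] == n].
Proof.
rewrite mem_undup; apply/imageP/exists_inP => [[x Gx ->]|[x Gx /eqP <-]].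
  by exists x.
by exists x.
Qed.

(** The number 1 and the prime divisors of #|G| are element orders, and by
    Burnside there are at least three such primes, so there are no other
    orders. *)
Lemma eta4_nonsolvable : size (primes #|G|) = 3 /\ prime_orders G.
Proof.
have uniq1 : uniq (1%N :: primes #|G|).
  by rewrite /= primes_uniq andbT mem_primes.
have sub : {subset 1%N :: primes #|G| <= omega G}.
  move=> n; rewrite mem_omega in_cons => /predU1P[->|].
    by apply/exists_inP; exists 1; rewrite ?order1.
  rewrite mem_primes => /and3P[n_pr _ /(Cauchy n_pr)[x Gx ox]].
  by apply/exists_inP; exists x; rewrite ?ox.
have pi3 : (2 < size (primes #|G|))%N.
  by rewrite ltnNge; apply: contra nsolG => /integral_char.Burnside_p_a_q_b.
have le_s := uniq_leq_size uniq1 sub; rewrite /= -/(eta G) etaG in le_s.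
split; first by apply/eqP; rewrite eqn_leq pi3 andbT -ltnS.
have eqo : (1%N :: primes #|G|) =i omega G.
  by have [] := uniq_min_size uniq1 sub; rewrite //= -/(eta G) etaG.
move=> x Gx ntx; have: #[x] \in omega G.
  by rewrite mem_omega; apply/exists_inP; exists x.
by rewrite -eqo in_cons order_eq1 (negPf ntx) mem_primes => /andP[].
Qed.

Lemma primes_even_three : ~~ odd #|G| -> size (primes #|G|) = 3 ->
  exists p r, primes #|G| = [:: 2; p; r].
Proof.
move=> evenG; have : 2 \in primes #|G| by rewrite mem_primes cardG_gt0 dvdn2.
have: all prime (primes #|G|) by apply/allP => p; rewrite mem_primes => /andP[].
have := sorted_primes #|G|.
case: (primes _) => [|a [|b [|c [|]]]] //= /and3P[ltab ltbc _] /and4P[pa _ _ _].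
have a1 := prime_gt1 pa; have {}ltbc := ltn_trans ltab ltbc.
rewrite !inE => /or3P[] /eqP e; first by rewrite -e; exists b, c.
  by rewrite -e ltnNge a1 in ltab.
by rewrite -e ltnNge a1 in ltbc.
Qed.

Lemma eta4_isog_Alt5 : G \isog 'Alt_('I_5).
Proof.
have [pi3 poG] := eta4_nonsolvable.
have [oddG|evenG] := boolP (odd #|G|).
  by case/negP: nsolG; apply: odd_prime_orders_solvable; rewrite ?pi3.
have [p [r piG]] := primes_even_three evenG pi3.
have [|t Gt ot] := Cauchy (isT : prime 2) (_ : 2 %| #|G|)%N; first by rewrite dvdn2.
have [oS oG] := order_sixty poG nsolG piG Gt ot.
have ncG := involutions_not_centralised poG nsolG piG.
exact: isog_Alt5_of_order_sixty poG ncG Gt ot oS oG.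
Qed.

End EtaFour.

Theorem theorem5p4 :
  [/\ ~~ solvable 'Alt_('I_5),
      eta 'Alt_('I_5) = 4
    & forall (gT : finGroupType) (G : {group gT}),
        ~~ solvable G -> eta G = 4 -> G \isog 'Alt_('I_5)].
Proof.
split; first by rewrite solvable_AltF ?card_ord.
  exact: eta_Alt5.
by move=> gT G; apply: eta4_isog_Alt5.
Qed.
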